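(* Let $X$ be a CBB$(0)$ space, let $Y$ be a complete CAT$(0)$ space and let $A \subseteq X$ be nonempty. Then the multivalued mapping $\Psi_c : \mathcal{L}(A,Y) \to \mathcal{P}(\mathcal{L}(X,Y))$, assigning to each $f\in\mathcal{L}(A,Y)$ the set of all $f'\in\mathcal{L}(X,Y)$ with $f'|_A=f$, $\mathrm{Lip}(f',X)=\mathrm{Lip}(f,A)$ and $f'(X)\subseteq\overline{\mathrm{co}}(f(A))$, is lower semi-continuous.
   Context: A geodesic space is CAT$(0)$ (resp. CBB$(0)$) if for every geodesic triangle, distances between points on it are $\le$ (resp. $\ge$) distances between corresponding points of its Euclidean comparison triangle. $\mathcal{L}(A,Y)$ is the set of bounded Lipschitz maps $A\to Y$ with the supremum metric; $\mathrm{Lip}(f,B)$ is the smallest Lipschitz constant of $f$ on $B$. For $C\subseteq Y$, $G_1(C)$ is the union of geodesic segments with endpoints in $C$, $G_n(C)=G_1(G_{n-1}(C))$, $\mathrm{co}(C)=\bigcup_nG_n(C)$, $\overline{\mathrm{co}}(C)$ its closure. Lower semi-continuity of $\Gamma:U\to\mathcal{P}(Z)$: $\{u:\Gamma(u)\cap V\ne\emptyset\}$ is open for every open $V$. *)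

(* Defs.v *)
From Stdlib Require Import Reals List.
Open Scope R_scope.

Section Defs.

Definition is_metric {T : Type} (d : T -> T -> R) : Prop :=
  (forall x y, 0 <= d x y) /\
  (forall x y, d x y = 0 <-> x = y) /\
  (forall x y, d x y = d y x) /\
  (forall x y z, d x z <= d x y + d y z).

Definition complete {T : Type} (d : T -> T -> R) : Prop :=
  forall u : nat -> T,
    (forall e, 0 < e -> exists N, forall m n, (N <= m)%nat -> (N <= n)%nat -> d (u m) (u n) < e) ->
    exists l, forall e, 0 < e -> exists N, forall n, (N <= n)%nat -> d (u n) l < e.

Definition geodesic {T : Type} (d : T -> T -> R) (g : R -> T) (p q : T) : Prop :=
  g 0 = p /\ g 1 = q /\
  forall s t, 0 <= s <= 1 -> 0 <= t <= 1 -> d (g s) (g t) = Rabs (s - t) * d p q.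

Definition geodesic_space {T : Type} (d : T -> T -> R) : Prop :=
  is_metric d /\ forall p q : T, exists g, geodesic d g p q.

Definition eucl (P Q : R * R) : R :=
  sqrt ((fst P - fst Q) ^ 2 + (snd P - snd Q) ^ 2).

Definition lerp (P Q : R * R) (s : R) : R * R :=
  ((1 - s) * fst P + s * fst Q, (1 - s) * snd P + s * snd Q).

(* Triangle comparison: for every geodesic triangle (vertices p q r, sides
   g1 : p->q, g2 : q->r, g3 : r->p) and every Euclidean comparison triangle
   P Q R, any two points on the triangle and their comparison points satisfy
   rel (distance in T) (Euclidean distance). *)
Definition triangle_comparison {T : Type} (d : T -> T -> R) (rel : R -> R -> Prop) : Prop :=
  forall (p q r : T) (g1 g2 g3 : R -> T) (P Q Rr : R * R),
    geodesic d g1 p q -> geodesic d g2 q r -> geodesic d g3 r p ->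
    eucl P Q = d p q -> eucl Q Rr = d q r -> eucl Rr P = d r p ->
    forall gi Ai Bi gj Aj Bj,
      In (gi, Ai, Bi) ((g1, P, Q) :: (g2, Q, Rr) :: (g3, Rr, P) :: nil) ->
      In (gj, Aj, Bj) ((g1, P, Q) :: (g2, Q, Rr) :: (g3, Rr, P) :: nil) ->
      forall s t, 0 <= s <= 1 -> 0 <= t <= 1 ->
        rel (d (gi s) (gj t)) (eucl (lerp Ai Bi s) (lerp Aj Bj t)).

Definition CAT0 {T : Type} (d : T -> T -> R) : Prop :=
  geodesic_space d /\ triangle_comparison d Rle.

Definition CBB0 {T : Type} (d : T -> T -> R) : Prop :=
  geodesic_space d /\ triangle_comparison d Rge.

Definition G1 {T : Type} (d : T -> T -> R) (C : T -> Prop) : T -> Prop :=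
  fun y => exists p q g t, C p /\ C q /\ geodesic d g p q /\ 0 <= t <= 1 /\ y = g t.

Fixpoint Gn {T : Type} (d : T -> T -> R) (C : T -> Prop) (n : nat) : T -> Prop :=
  match n with
  | O => C
  | S m => G1 d (Gn d C m)
  end.

Definition co {T : Type} (d : T -> T -> R) (C : T -> Prop) : T -> Prop :=
  fun y => exists n, Gn d C n y.

Definition closure {T : Type} (d : T -> T -> R) (S : T -> Prop) : T -> Prop :=
  fun y => forall e, 0 < e -> exists z, S z /\ d y z < e.

Definition clco {T : Type} (d : T -> T -> R) (C : T -> Prop) : T -> Prop :=
  closure d (co d C).

Definition lip_const {S T : Type} (dS : S -> S -> R) (dT : T -> T -> R)
  (f : S -> T) (K : R) : Prop :=
  0 <= K /\ forall x y, dT (f x) (f y) <= K * dS x y.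

Definition is_Lip {S T : Type} (dS : S -> S -> R) (dT : T -> T -> R)
  (f : S -> T) (L : R) : Prop :=
  lip_const dS dT f L /\ forall K, lip_const dS dT f K -> L <= K.

Definition bdd_lip {S T : Type} (dS : S -> S -> R) (dT : T -> T -> R)
  (f : S -> T) : Prop :=
  (exists M, forall x y, dT (f x) (f y) <= M) /\ (exists K, lip_const dS dT f K).

Definition sup_dist_lt {S T : Type} (dT : T -> T -> R) (f g : S -> T) (e : R) : Prop :=
  exists e', e' < e /\ forall x, dT (f x) (g x) <= e'.

Definition open_in_L {S T : Type} (dS : S -> S -> R) (dT : T -> T -> R)
  (U : (S -> T) -> Prop) : Prop :=
  (forall f, U f -> bdd_lip dS dT f) /\
  forall f, U f -> exists e, 0 < e /\
    forall g, bdd_lip dS dT g -> sup_dist_lt dT f g e -> U g.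

Definition lsc {S T S' T' : Type} (dS : S -> S -> R) (dT : T -> T -> R)
  (dS' : S' -> S' -> R) (dT' : T' -> T' -> R)
  (Gamma : (S -> T) -> (S' -> T') -> Prop) : Prop :=
  forall V, open_in_L dS' dT' V ->
    open_in_L dS dT (fun f => bdd_lip dS dT f /\ exists h, Gamma f h /\ V h).

Definition subdist {X : Type} (dX : X -> X -> R) (A : X -> Prop)
  (a b : {x : X | A x}) : R := dX (proj1_sig a) (proj1_sig b).

Definition Psi_c {X Y : Type} (dX : X -> X -> R) (dY : Y -> Y -> R) (A : X -> Prop)
  (f : {x : X | A x} -> Y) (f' : X -> Y) : Prop :=
  bdd_lip dX dY f' /\
  (forall a : {x : X | A x}, f' (proj1_sig a) = f a) /\
  (exists L, is_Lip (subdist dX A) dY f L /\ is_Lip dX dY f' L) /\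
  (forall x, clco dY (fun y => exists a, f a = y) (f' x)).

End Defs.

(* Main.v *)
Require Import Defs.
From Stdlib Require Import Reals List Lra Lia Psatz Classical IndefiniteDescription.
From mathcomp Require classical_sets.

(** Kopecka's bootstrapping of Kirszbraun's theorem.  Let [f'] be a prescribed
    extension of [f], and let [g] be close to [f], with Lipschitz constant [K].
    Contract [f'] slightly towards a point to a [K]-Lipschitz map [h]; this is
    possible because the Lipschitz constant is lower semicontinuous in [f].  On
    [X * R], prescribe [g] on [A * {0}] and [h] on [X * {rho}], where the second
    coordinate is not multiplied by [K]: boundedness of [f'] makes this
    compatible with a metric extension once [g] is close enough to [f].  A
    Kirszbraun extension restricted to [X * {0}] stays within [rho] of [h], and
    the nearest-point projection to the closed convex hull of [g(A)] corrects
    its range.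

    The extension theorem needs from its source only the Lang-Schroeder-Sturm
    inequality for the squared distance; this property passes to sums, and hence
    to [X * R]. *)

(** * Stewart's inequality in CAT(0) and CBB(0) spaces *)

Lemma eucl_nonneg (P Q : R * R) : 0 <= eucl P Q.
Proof. apply sqrt_pos. Qed.

Lemma eucl_sq (P Q : R * R) :
  eucl P Q ^ 2 = (fst P - fst Q) ^ 2 + (snd P - snd Q) ^ 2.
Proof. unfold eucl. apply pow2_sqrt. apply Rplus_le_le_0_compat; apply pow2_ge_0. Qed.

Lemma eucl_eq (P Q : R * R) (a : R) :
  0 <= a -> (fst P - fst Q) ^ 2 + (snd P - snd Q) ^ 2 = a ^ 2 -> eucl P Q = a.
Proof. intros Ha H. unfold eucl. rewrite H. now apply sqrt_pow2. Qed.

(** Put the side of length [c] on the first axis. The law of cosines then gives the abscissa [x] of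
    the apex, and the triangle inequalities give [x^2 <= b^2], so that the ordinate exists. *)
Lemma comparison_triangle (a b c : R) :
  0 <= a -> 0 <= b -> 0 <= c -> a <= b + c -> b <= a + c -> c <= a + b ->
  exists P Q S : R * R, eucl P Q = c /\ eucl Q S = a /\ eucl S P = b.
Proof.
  intros Ha Hb Hc H1 H2 H3.
  destruct (Req_dec c 0) as [-> | Hc0].
  - exists (0, 0), (0, 0), (b, 0).
    assert (a = b) by lra; subst a.
    repeat split; apply eucl_eq; simpl; lra.
  - set (x := (b ^ 2 + c ^ 2 - a ^ 2) / (2 * c)).
    assert (Hx : 2 * c * x = b ^ 2 + c ^ 2 - a ^ 2) by (unfold x; field; lra).
    assert (Hxb : x ^ 2 <= b ^ 2).
    { assert ((2 * c * x) ^ 2 <= (2 * c * b) ^ 2).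
      { rewrite Hx.
        (* Heron's product equals [4 * b^2 * c^2 - (b^2 + c^2 - a^2)^2]. *)
        assert (0 <= (a + b - c) * (a + c - b) * ((b + c - a) * (a + b + c))) by
          (repeat apply Rmult_le_pos; lra).
        nra. }
      assert (0 < 4 * c ^ 2) by nra. nra. }
    exists (0, 0), (c, 0), (x, sqrt (b ^ 2 - x ^ 2)).
    assert (Hs : sqrt (b ^ 2 - x ^ 2) ^ 2 = b ^ 2 - x ^ 2) by (apply pow2_sqrt; lra).
    repeat split; apply eucl_eq; cbn [fst snd]; nra.
Qed.

Lemma geodesic_range {T : Type} (d : T -> T -> R) (g : R -> T) (p q : T) (t : R) :
  geodesic d g p q -> 0 <= t <= 1 ->
  d p (g t) = t * d p q /\ d (g t) q = (1 - t) * d p q.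
Proof.
  intros (H0 & H1 & H) Ht. rewrite <- H0 at 1. rewrite <- H1 at 2.
  rewrite !H by lra. split; f_equal.
  - rewrite Rabs_left1; lra.
  - rewrite Rabs_left1; lra.
Qed.

(** Compare [g t] with the opposite vertex [r], seen as the end of the side from [q]. The length [e]
    of the Euclidean cevian is given by Stewart's identity; an abstract [rel] serves both curvature
    bounds. *)
Lemma stewart_comparison {T : Type} (d : T -> T -> R) (rel : R -> R -> Prop)
  (g : R -> T) (p q r : T) (t : R) :
  geodesic_space d -> triangle_comparison d rel -> geodesic d g p q -> 0 <= t <= 1 ->
  exists e, 0 <= e /\ rel (d (g t) r) e /\
    e ^ 2 = (1 - t) * d p r ^ 2 + t * d q r ^ 2 - t * (1 - t) * d p q ^ 2.
Proof.
  intros [(Hnn & H0 & Hs & Htr) Hg] Hc Hgeo Ht.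
  destruct (Hg q r) as [g2 Hg2]. destruct (Hg r p) as [g3 Hg3].
  pose proof (Htr q p r); pose proof (Htr r q p); pose proof (Htr p r q).
  pose proof (Hs p q); pose proof (Hs q r); pose proof (Hs r p).
  destruct (comparison_triangle (d q r) (d r p) (d p q)) as (P & Q & S & HPQ & HQS & HSP);
    auto; try lra.
  - exists (eucl (lerp P Q t) (lerp Q S 1)). split; [apply eucl_nonneg|]. split.
    + rewrite <- (proj1 (proj2 Hg2)) at 1.
      apply (Hc p q r g g2 g3 P Q S); auto; [left | right; left | lra]; reflexivity.
    + rewrite <- HPQ, <- HQS, (Hs p r), <- HSP, !eucl_sq. simpl. ring.
Qed.

Lemma cat0_stewart {T : Type} (d : T -> T -> R) (g : R -> T) (p q r : T) (t : R) :
  CAT0 d -> geodesic d g p q -> 0 <= t <= 1 ->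
  d (g t) r ^ 2 <= (1 - t) * d p r ^ 2 + t * d q r ^ 2 - t * (1 - t) * d p q ^ 2.
Proof.
  intros [Hd Hc] Hg Ht.
  destruct (stewart_comparison d Rle g p q r t) as (e & He & Hle & <-); auto.
  apply pow_incr. split; [apply Hd | exact Hle].
Qed.

Lemma cbb0_stewart {T : Type} (d : T -> T -> R) (g : R -> T) (p q r : T) (t : R) :
  CBB0 d -> geodesic d g p q -> 0 <= t <= 1 ->
  (1 - t) * d p r ^ 2 + t * d q r ^ 2 - t * (1 - t) * d p q ^ 2 <= d (g t) r ^ 2.
Proof.
  intros [Hd Hc] Hg Ht.
  destruct (stewart_comparison d Rge g p q r t) as (e & He & Hle & <-); auto.
  apply pow_incr. split; [exact He | apply Rge_le; exact Hle].
Qed.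

(** * The Lang-Schroeder-Sturm inequality *)

(** A weighted list stands for a finitely supported measure, and [wsum] for integration against it.
    Points may repeat, so concatenation is addition of measures. *)
Definition wsum {T : Type} (l : list (R * T)) (F : T -> R) : R :=
  fold_right (fun wx s => fst wx * F (snd wx) + s) 0 l.

Definition nonneg_weights {T : Type} (l : list (R * T)) : Prop :=
  Forall (fun wx => 0 <= fst wx) l.

Definition total_weight {T : Type} (l : list (R * T)) : R := wsum l (fun _ => 1).

Lemma wsum_ext {T : Type} (l : list (R * T)) (F G : T -> R) :
  (forall x, F x = G x) -> wsum l F = wsum l G.
Proof. intros H. induction l; simpl; [|rewrite H, IHl]; reflexivity. Qed.

Lemma wsum_app {T : Type} (l1 l2 : list (R * T)) (F : T -> R) :
  wsum (l1 ++ l2) F = wsum l1 F + wsum l2 F.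
Proof. induction l1; simpl; [|rewrite IHl1]; ring. Qed.

Definition push_weights {S T : Type} (h : S -> T) (l : list (R * S)) : list (R * T) :=
  map (fun wx => (fst wx, h (snd wx))) l.

Lemma wsum_push {S T : Type} (l : list (R * S)) (h : S -> T) (F : T -> R) :
  wsum (push_weights h l) F = wsum l (fun x => F (h x)).
Proof. induction l; simpl; [|rewrite IHl]; reflexivity. Qed.

Lemma wsum_scale {T : Type} (l : list (R * T)) (c : R) (F : T -> R) :
  wsum (map (fun wx => (c * fst wx, snd wx)) l) F = c * wsum l F.
Proof. induction l; simpl; [|rewrite IHl]; ring. Qed.

Lemma wsum_plus {T : Type} (l : list (R * T)) (F G : T -> R) :
  wsum l (fun x => F x + G x) = wsum l F + wsum l G.
Proof. induction l; simpl; [|rewrite IHl]; ring. Qed.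

Lemma wsum_mult {T : Type} (l : list (R * T)) (c : R) (F : T -> R) :
  wsum l (fun x => c * F x) = c * wsum l F.
Proof. induction l; simpl; [|rewrite IHl]; ring. Qed.

Lemma wsum_const {T : Type} (l : list (R * T)) (c : R) :
  wsum l (fun _ => c) = c * total_weight l.
Proof. unfold total_weight. rewrite <- wsum_mult. apply wsum_ext. intros; ring. Qed.

Lemma wsum_le_on {T : Type} (P : T -> Prop) (l : list (R * T)) (F G : T -> R) :
  nonneg_weights l -> Forall (fun wx => P (snd wx)) l ->
  (forall x, P x -> F x <= G x) -> wsum l F <= wsum l G.
Proof.
  intros Hl HP H. induction l; simpl; [lra|].
  inversion_clear Hl; inversion_clear HP.
  apply Rplus_le_compat; auto. now apply Rmult_le_compat_l; auto.
Qed.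

Lemma wsum_le {T : Type} (l : list (R * T)) (F G : T -> R) :
  nonneg_weights l -> (forall x, F x <= G x) -> wsum l F <= wsum l G.
Proof.
  intros Hl H. apply (wsum_le_on (fun _ => True)); auto.
  apply Forall_forall; auto.
Qed.

Lemma total_weight_nonneg {T : Type} (l : list (R * T)) :
  nonneg_weights l -> 0 <= total_weight l.
Proof.
  intros Hl. apply Rle_trans with (wsum l (fun _ => 0)).
  - rewrite wsum_const. lra.
  - apply wsum_le; auto. intros; lra.
Qed.

(* The Lang-Schroeder-Sturm inequality, for [D] in the role of a squared distance. *)
Definition lss {Z : Type} (D : Z -> Z -> R) : Prop :=
  forall p l, nonneg_weights l ->
    0 <= wsum l (fun a => wsum l (fun b => D p a + D p b - D a b)).

(** By the law of cosines, this is the inner product of the two sides issuing from [p] in a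
    Euclidean comparison triangle. *)
Definition dot {T : Type} (d : T -> T -> R) (p a b : T) : R :=
  (d p a ^ 2 + d p b ^ 2 - d a b ^ 2) / 2.

Lemma geodesic_initial {T : Type} (d : T -> T -> R) (g : R -> T) (p q : T) (s : R) :
  geodesic d g p q -> 0 <= s <= 1 -> geodesic d (fun t => g (s * t)) p (g s).
Proof.
  intros Hg Hs. destruct (geodesic_range d g p q s Hg Hs) as [Hps _].
  destruct Hg as (H0 & H1 & H). repeat split.
  - now rewrite Rmult_0_r.
  - now rewrite Rmult_1_r.
  - intros t t' Ht Ht'. rewrite H, Hps by nra.
    replace (s * t - s * t') with (s * (t - t')) by ring.
    rewrite Rabs_mult, (Rabs_right s) by lra. ring.
Qed.

Lemma dot_comm {T : Type} (d : T -> T -> R) (p a b : T) :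
  is_metric d -> dot d p a b = dot d p b a.
Proof. intros (_ & _ & Hs & _). unfold dot. rewrite (Hs a b). lra. Qed.

(** The triangle inequality acts as one half of the Cauchy-Schwarz inequality. It will bound the
    rescaled products from below. *)
Lemma dot_lower {T : Type} (d : T -> T -> R) (p a b : T) :
  is_metric d -> - (d p a * d p b) <= dot d p a b.
Proof.
  intros (Hnn & _ & Hs & Htr). unfold dot.
  pose proof (Htr a p b) as H. rewrite (Hs a p) in H.
  pose proof (Hnn a b).
  assert (d a b ^ 2 <= (d p a + d p b) ^ 2) by (apply pow_incr; lra).
  nra.
Qed.

(** Stewart's inequality rearranged: comparison angles at [p] can only grow as a point moves towards
    [p] along a geodesic. *)
Lemma dot_geodesic {T : Type} (d : T -> T -> R) (g : R -> T) (p a b : T) (t : R) :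
  CBB0 d -> geodesic d g p b -> 0 <= t <= 1 -> dot d p a (g t) <= t * dot d p a b.
Proof.
  intros Hd Hg Ht. pose proof (cbb0_stewart d g p b a t Hd Hg Ht) as H.
  destruct (geodesic_range d g p b t Hg Ht) as [E _].
  destruct Hd as [[(_ & _ & Hs & _) _] _].
  unfold dot. rewrite E, (Hs a (g t)), (Hs a b). nra.
Qed.

Lemma dot_geodesic2 {T : Type} (d : T -> T -> R) (g h : R -> T) (p a b : T) (s t : R) :
  CBB0 d -> geodesic d g p a -> geodesic d h p b -> 0 <= s <= 1 -> 0 <= t <= 1 ->
  dot d p (g s) (h t) <= s * t * dot d p a b.
Proof.
  intros Hd Hg Hh Hs Ht. assert (Hm := proj1 (proj1 Hd)).
  pose proof (dot_geodesic d h p (g s) b t Hd Hh Ht).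
  pose proof (dot_geodesic d g p b a s Hd Hg Hs).
  rewrite (dot_comm d p (g s) b Hm) in H.
  rewrite (dot_comm d p b a Hm) in H0. nra.
Qed.

(* The reverse of [cbb0_stewart], up to an error measuring how far the triangle
   [p, r, v] is from being flat along the cevian from [v] to the midpoint [u]
   of [p] and [r]. *)
Lemma cbb0_reverse_stewart {T : Type} (d : T -> T -> R) (h g : R -> T) (p r v : T) (mu : R) :
  CBB0 d -> geodesic d h p r -> geodesic d g (h (1/2)) v -> 0 <= mu <= 1 ->
  let u := h (1/2) in
  d p (g mu) ^ 2 <= (1 - mu) * d p u ^ 2 + mu * d p v ^ 2 - mu * (1 - mu) * d u v ^ 2
    + 2 * mu * (dot d p v r - 2 * dot d p v u).
Proof.
  intros Hd Hh Hg Hmu u. fold u in Hg. unfold dot.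
  pose proof (cbb0_stewart d h p r (g mu) (1/2) Hd Hh ltac:(lra)) as HA. fold u in HA.
  pose proof (cbb0_stewart d g u v r mu Hd Hg Hmu) as HB.
  destruct (geodesic_range d h p r (1/2) Hh ltac:(lra)) as [E1 E2]. fold u in E1, E2.
  destruct (geodesic_range d g u v mu Hg Hmu) as [E3 _].
  destruct Hd as [[(_ & _ & Hs & _) _] _].
  rewrite (Hs (g mu) r) in HB. rewrite E3 in HA. rewrite E2 in HB.
  rewrite (Hs v u). rewrite E1. nra.
Qed.

(** Otherwise [f] would drop by at least [eta] at each halving of the argument, starting from 1, and
    would fall below [m]. *)
Lemma small_dyadic_increment (f : R -> R) (m eta : R) :
  0 < eta -> (forall s, 0 < s <= 1 -> m <= f s) ->
  exists s, 0 < s <= 1/2 /\ f (2 * s) - f s < eta.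
Proof.
  intros Heta Hm. apply NNPP. intros Hno.
  assert (Hdec : forall n, 0 < (1/2) ^ n <= 1 /\ f ((1/2) ^ n) <= f 1 - INR n * eta).
  { induction n as [|n [IH1 IH2]].
    - simpl. lra.
    - assert (Hs : 0 < (1/2) ^ S n <= 1/2) by (simpl; lra).
      split; [lra|]. rewrite S_INR.
      destruct (Rlt_dec (f (2 * (1/2) ^ S n) - f ((1/2) ^ S n)) eta) as [H|H].
      + exfalso. apply Hno. eauto.
      + replace (2 * (1/2) ^ S n) with ((1/2) ^ n) in H by (simpl; field). lra. }
  destruct (INR_archimed eta (f 1 - m) Heta) as [n Hn].
  destruct (Hdec n) as [H1 H2]. specialize (Hm _ H1). lra.
Qed.

(* Two points are merged at a small scale [s]: by Stewart's inequality in both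
   directions their weighted average [m] behaves like a vector sum, up to
   [o(s^2)]. *)
Lemma cbb0_lss_dot {T : Type} (d : T -> T -> R) (p : T) (l : list (R * T)) :
  CBB0 d -> nonneg_weights l -> 0 <= wsum l (fun a => wsum l (fun b => dot d p a b)).
Proof.
  intros Hd. assert (Hm := proj1 (proj1 Hd)).
  destruct (functional_choice (fun x g => geodesic d g p x) (proj2 (proj1 Hd) p)) as [G HG].
  remember (length l) as n eqn:Hn. revert l Hn.
  induction n as [|n IH]; intros [|[w1 x1] l] Hn Hl; try discriminate; [simpl; lra|].
  destruct l as [|[w2 x2] l].
  { simpl. unfold dot. destruct Hm as (_ & H0 & _). rewrite (proj2 (H0 x1 x1) eq_refl).
    pose proof (pow2_ge_0 (d p x1)). pose proof (Rle_0_sqr w1). unfold Rsqr in *. nra. }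
  inversion_clear Hl as [|? ? Hw1 Hl']. inversion_clear Hl' as [|? ? Hw2 Hl].
  cbn [fst snd] in Hw1, Hw2.
  set (Q := fun x => wsum l (fun b => dot d p x b)).
  assert (HS : forall y1 l', wsum ((y1 : R * T) :: l') (fun a => wsum (y1 :: l') (fun b => dot d p a b))
     = fst y1 ^ 2 * d p (snd y1) ^ 2
       + 2 * fst y1 * wsum l' (fun b => dot d p (snd y1) b)
       + wsum l' (fun a => wsum l' (fun b => dot d p a b))).
  { intros [c y] l'. simpl. rewrite wsum_plus, wsum_mult.
    rewrite (wsum_ext l' (fun x => dot d p x y) (fun x => dot d p y x))
      by (intros; now apply dot_comm).
    unfold dot at 1. rewrite (proj2 ((proj1 (proj2 Hm)) y y) eq_refl). field. }
  assert (E : wsum ((w1, x1) :: (w2, x2) :: l)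
      (fun a => wsum ((w1, x1) :: (w2, x2) :: l) (fun b => dot d p a b))
    = w1 ^ 2 * d p x1 ^ 2 + w2 ^ 2 * d p x2 ^ 2 + 2 * w1 * w2 * dot d p x1 x2
      + 2 * w1 * Q x1 + 2 * w2 * Q x2 + wsum l Q).
  { rewrite !HS. simpl. unfold Q. ring. }
  rewrite E. clear E.
  (* The merged point needs a positive weight [W]. If both weights vanish, one of the two points is
     simply dropped. *)
  destruct (Req_dec (w1 + w2) 0) as [Hz|Hz].
  { assert (w1 = 0) by lra. assert (w2 = 0) by lra. subst w1 w2.
    assert (IHl : 0 <= wsum ((0, x1) :: l) (fun a => wsum ((0, x1) :: l) (fun b => dot d p a b))).
    { apply IH; [now injection Hn as ->|]. constructor; [simpl; lra | exact Hl]. }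
    rewrite HS in IHl. cbn [fst snd] in IHl. fold Q in IHl.
    unfold Q in *. lra. }
  set (W := w1 + w2) in *. set (mu := w2 / W).
  assert (HW : 0 < W) by (unfold W in *; lra).
  assert (Hmu1 : W * mu = w2) by (unfold mu; now field).
  assert (Hmu2 : W * (1 - mu) = w1) by (unfold W in *; lra).
  assert (Hmu : 0 <= mu <= 1) by (split; nra).
  assert (HV := total_weight_nonneg l Hl). set (V := total_weight l) in *.
  apply le_epsilon. intros eps Heps.
  (* The errors made below add up to [4 * eta * (W^2 + W * V)] after division by [s^2]. *)
  set (eta := eps / (4 * (W ^ 2 + W * V + 1))).
  assert (Hden : 0 < W ^ 2 + W * V + 1) by nra.
  assert (Heta : 0 < eta) by (unfold eta; apply Rdiv_lt_0_compat; lra).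
  (* At this scale the normalized product changes by less than [eta] on passing from [s] to [2 * s],
     so the configuration is almost flat. *)
  destruct (small_dyadic_increment (fun s => dot d p (G x1 s) (G x2 s) / s ^ 2)
    (- (d p x1 * d p x2)) eta Heta) as (s & Hs & Hinc).
  { intros s Hs. pose proof (dot_lower d p (G x1 s) (G x2 s) Hm) as H.
    rewrite (proj1 (geodesic_range d _ _ _ s (HG x1) ltac:(lra))) in H.
    rewrite (proj1 (geodesic_range d _ _ _ s (HG x2) ltac:(lra))) in H.
    apply Rmult_le_reg_r with (s ^ 2); [nra|]. unfold Rdiv.
    rewrite Rmult_assoc, Rinv_l by nra. lra. }
  set (u := G x1 s). set (v := G x2 s). set (r := G x1 (2 * s)).
  destruct (proj2 (proj1 Hd) u v) as [g Hg]. set (m := g mu).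
  assert (Hur : geodesic d (fun t => G x1 (2 * s * t)) p r)
    by (apply geodesic_initial with x1; auto; lra).
  assert (Hmid : u = (fun t => G x1 (2 * s * t)) (1/2)) by (unfold u; f_equal; field).
  (* Halving the side towards [G x2 (2 * s)] bounds [dot d p v r] by half the product at scale
     [2 * s]. The difference is thus at most [2 * s^2] times the increment just controlled. *)
  assert (Herr : dot d p v r - 2 * dot d p v u <= 2 * s ^ 2 * eta).
  { assert (H2s : geodesic d (fun t => G x2 (2 * s * t)) p (G x2 (2 * s)))
      by (apply geodesic_initial with x2; auto; lra).
    pose proof (dot_geodesic d _ p r _ (1/2) Hd H2s ltac:(lra)) as H.
    cbv beta in H. replace (2 * s * (1/2)) with s in H by field. fold v in H.
    rewrite (dot_comm d p r v Hm) in H.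
    rewrite (dot_comm d p v u Hm). fold u v in Hinc. fold r in Hinc.
    set (a := dot d p r (G x2 (2 * s))) in *. set (b := dot d p u v) in *.
    assert (a / (2 * s) ^ 2 - b / s ^ 2 = (a / 4 - b) / s ^ 2) as Hr by (field; lra).
    rewrite Hr in Hinc.
    apply (Rmult_lt_compat_r (s ^ 2)) in Hinc; [|nra].
    unfold Rdiv at 1 in Hinc. rewrite Rmult_assoc, Rinv_l in Hinc by nra. lra. }
  set (flat := (1 - mu) * d p u ^ 2 + mu * d p v ^ 2 - mu * (1 - mu) * d u v ^ 2).
  assert (Hflat : d p m ^ 2 <= flat + 4 * s ^ 2 * eta).
  { pose proof (cbb0_reverse_stewart d _ g p r v mu Hd Hur) as H.
    cbv zeta in H. cbv beta in Hmid, H. rewrite <- Hmid in H.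
    specialize (H Hg Hmu). fold m flat in H.
    assert (0 <= s ^ 2 * eta) by (apply Rmult_le_pos; [apply pow2_ge_0 | lra]).
    apply (Rmult_le_compat_l (2 * mu)) in Herr; [|lra].
    assert (mu * (s ^ 2 * eta) <= 1 * (s ^ 2 * eta)) by (apply Rmult_le_compat_r; lra).
    lra. }
  (* The product is almost linear in its first argument: Stewart's inequality bounds the distance
     from [m] to [G b s] below, and [Hflat] bounds that from [p] to [m] above. *)
  assert (Hdotm : forall b, dot d p m (G b s)
     <= s ^ 2 * ((1 - mu) * dot d p x1 b + mu * dot d p x2 b + 2 * eta)).
  { intros b. pose proof (cbb0_stewart d g u v (G b s) mu Hd Hg Hmu) as H. fold m in H.
    pose proof (dot_geodesic2 d _ _ p x1 b s s Hd (HG x1) (HG b) ltac:(lra) ltac:(lra)) as H1.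
    pose proof (dot_geodesic2 d _ _ p x2 b s s Hd (HG x2) (HG b) ltac:(lra) ltac:(lra)) as H2.
    fold u in H1. fold v in H2.
    assert (H3 : dot d p m (G b s) <= (1 - mu) * dot d p u (G b s) + mu * dot d p v (G b s)
       + 2 * s ^ 2 * eta) by (unfold dot; unfold flat in Hflat; lra).
    nra. }
  assert (Huv : flat <= s ^ 2 * ((1 - mu) ^ 2 * d p x1 ^ 2 + mu ^ 2 * d p x2 ^ 2
      + 2 * mu * (1 - mu) * dot d p x1 x2)).
  { pose proof (dot_geodesic2 d _ _ p x1 x2 s s Hd (HG x1) (HG x2) ltac:(lra) ltac:(lra)) as H.
    fold u v in H.
    assert (flat = (1 - mu) ^ 2 * d p u ^ 2 + mu ^ 2 * d p v ^ 2
      + 2 * mu * (1 - mu) * dot d p u v) as -> by (unfold flat, dot; field).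
    unfold u at 1, v at 1.
    rewrite (proj1 (geodesic_range d _ _ _ s (HG x1) ltac:(lra))).
    rewrite (proj1 (geodesic_range d _ _ _ s (HG x2) ltac:(lra))).
    assert (0 <= mu * (1 - mu)) by nra. nra. }
  (* The other points are contracted to the same scale [s]; with [m] of weight [W] in place of [x1]
     and [x2], the list is one shorter. *)
  set (l' := push_weights (fun x => G x s) l).
  assert (HIH : 0 <= wsum ((W, m) :: l') (fun a => wsum ((W, m) :: l') (fun b => dot d p a b))).
  { apply IH; [simpl; unfold l', push_weights; rewrite length_map; now injection Hn as -> |].
    constructor; [simpl; lra|]. unfold l'. apply Forall_map. exact Hl. }
  rewrite HS in HIH. cbn [fst snd] in HIH. unfold l' in HIH. rewrite !wsum_push in HIH.
  assert (HQm : wsum l (fun x => dot d p m (G x s))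
     <= s ^ 2 * ((1 - mu) * Q x1 + mu * Q x2 + 2 * eta * V)).
  { eapply Rle_trans; [apply wsum_le; [exact Hl | exact Hdotm] |].
    rewrite wsum_mult, !wsum_plus, !wsum_mult, wsum_const. fold V.
    change (wsum l (dot d p x1)) with (Q x1). change (wsum l (dot d p x2)) with (Q x2). lra. }
  assert (HQ : wsum l (fun x => wsum (push_weights (fun x => G x s) l)
      (fun b => dot d p (G x s) b)) <= s ^ 2 * wsum l Q).
  { rewrite <- wsum_mult. apply wsum_le; auto. intros x. rewrite wsum_push.
    unfold Q. rewrite <- wsum_mult. apply wsum_le; auto. intros y.
    pose proof (dot_geodesic2 d _ _ p x y s s Hd (HG x) (HG y) ltac:(lra) ltac:(lra)).
    cbv beta. lra. }
  assert (Hfin : 0 <= s ^ 2 * (w1 ^ 2 * d p x1 ^ 2 + w2 ^ 2 * d p x2 ^ 2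
      + 2 * w1 * w2 * dot d p x1 x2 + 2 * w1 * Q x1 + 2 * w2 * Q x2 + wsum l Q
      + 4 * eta * (W ^ 2 + W * V))).
  { assert (W ^ 2 * d p m ^ 2 <= W ^ 2 * (flat + 4 * s ^ 2 * eta))
      by (apply Rmult_le_compat_l; nra).
    assert (W ^ 2 * flat <= W ^ 2 * (s ^ 2 * ((1 - mu) ^ 2 * d p x1 ^ 2 + mu ^ 2 * d p x2 ^ 2
      + 2 * mu * (1 - mu) * dot d p x1 x2))) by (apply Rmult_le_compat_l; nra).
    assert (2 * W * wsum l (fun x => dot d p m (G x s))
      <= 2 * W * (s ^ 2 * ((1 - mu) * Q x1 + mu * Q x2 + 2 * eta * V)))
      by (apply Rmult_le_compat_l; lra).
    rewrite <- Hmu1, <- Hmu2. lra. }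
  assert (Heps' : 4 * eta * (W ^ 2 + W * V) <= eps).
  { apply Rle_trans with (4 * eta * (W ^ 2 + W * V + 1)); [lra|].
    unfold eta. right. field. lra. }
  apply Rmult_le_reg_l with (s ^ 2); [nra|]. nra.
Qed.

Lemma cbb0_lss {T : Type} (d : T -> T -> R) : CBB0 d -> lss (fun a b => d a b ^ 2).
Proof.
  intros Hd p l Hl.
  rewrite (wsum_ext l _ (fun a => 2 * wsum l (fun b => dot d p a b))).
  - rewrite wsum_mult. pose proof (cbb0_lss_dot d p l Hd Hl). lra.
  - intros a. rewrite <- wsum_mult. apply wsum_ext. intros b. unfold dot. field.
Qed.

(** * One-point extension *)

Lemma lss_plus {Z : Type} (D1 D2 : Z -> Z -> R) :
  lss D1 -> lss D2 -> lss (fun a b => D1 a b + D2 a b).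
Proof.
  intros H1 H2 p l Hl. specialize (H1 p l Hl). specialize (H2 p l Hl).
  eapply Rle_trans; [apply (Rplus_le_le_0_compat _ _ H1 H2)|]. right.
  rewrite <- wsum_plus. apply wsum_ext. intros a.
  rewrite <- wsum_plus. apply wsum_ext. intros b. ring.
Qed.

Lemma lss_scale {Z : Type} (D : Z -> Z -> R) (c : R) :
  0 <= c -> lss D -> lss (fun a b => c * D a b).
Proof.
  intros Hc H p l Hl. specialize (H p l Hl).
  eapply Rle_trans; [apply (Rmult_le_pos _ _ Hc H)|]. right.
  rewrite <- wsum_mult. apply wsum_ext. intros a.
  rewrite <- wsum_mult. apply wsum_ext. intros b. ring.
Qed.

Lemma lss_pullback {Z Z' : Type} (D : Z' -> Z' -> R) (h : Z -> Z') :
  lss D -> lss (fun a b => D (h a) (h b)).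
Proof.
  intros H p l Hl.
  assert (Hl' : nonneg_weights (push_weights h l)) by (apply Forall_map; exact Hl).
  specialize (H (h p) _ Hl'). rewrite wsum_push in H.
  erewrite wsum_ext in H; [exact H|]. intros a. simpl. now rewrite wsum_push.
Qed.

(** The summand is [2 * (a - p) * (b - p)], so the double sum is twice a square. *)
Lemma lss_R : lss (fun a b : R => (a - b) ^ 2).
Proof.
  intros p l Hl.
  rewrite (wsum_ext l _ (fun a => (2 * wsum l (fun b => b - p)) * (a - p))).
  - rewrite wsum_mult. pose proof (Rle_0_sqr (wsum l (fun b => b - p))) as H.
    unfold Rsqr in H. lra.
  - intros a. rewrite (Rmult_comm 2), Rmult_assoc, Rmult_comm. rewrite <- wsum_mult.
    apply wsum_ext. intros b. ring.
Qed.

(** Points chosen in [Q (1 / (n + 1))] form a Cauchy sequence. The sets need not be closed, so the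
    limit is described only through nearby points of them. *)
Lemma complete_shrinking {Y : Type} (d : Y -> Y -> R) (Q : R -> Y -> Prop) :
  is_metric d -> complete d ->
  (forall e, 0 < e -> exists y, Q e y) ->
  (forall e e' y, e <= e' -> Q e y -> Q e' y) ->
  (forall e, 0 < e -> exists e', 0 < e' /\ forall y z, Q e' y -> Q e' z -> d y z < e) ->
  exists l, forall e, 0 < e -> exists y, Q e y /\ d y l < e.
Proof.
  intros Hm Hc Hex Hmono Hsmall.
  destruct (functional_choice (fun (n : nat) y => Q (/ INR (S n)) y)) as [u Hu].
  { intros n. apply Hex. apply Rinv_0_lt_compat, lt_0_INR. lia. }
  assert (Hev : forall e, 0 < e -> exists N, forall n, (N <= n)%nat -> Q e (u n)).
  { intros e He. destruct (archimed_cor1 e He) as (N & HN & HN0).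
    exists N. intros n Hn. apply (Hmono (/ INR (S n))); [|apply Hu].
    left. eapply Rle_lt_trans; [|exact HN].
    apply Rinv_le_contravar; [apply lt_0_INR; lia | apply le_INR; lia]. }
  destruct (Hc u) as [l Hl].
  { intros e He. destruct (Hsmall e He) as (e' & He' & H).
    destruct (Hev e' He') as [N HN]. exists N. intros m n Hm' Hn'. apply H; auto. }
  exists l. intros e He. destruct (Hev e He) as [N1 HN1]. destruct (Hl e He) as [N2 HN2].
  exists (u (Nat.max N1 N2)). split; [apply HN1 | apply HN2]; lia.
Qed.

(** * Minimizers of strongly convex functions and barycentres *)

Definition lower_semicont {Y : Type} (d : Y -> Y -> R) (F : Y -> R) : Prop :=
  forall y e, 0 < e -> exists r, 0 < r /\ forall z, d y z < r -> F y <= F z + e.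

Definition strongly_convex {Y : Type} (d : Y -> Y -> R) (C : Y -> Prop) (F : Y -> R) : Prop :=
  forall a b t, C a -> C b -> 0 <= t <= 1 ->
    exists c, C c /\ F c <= (1 - t) * F a + t * F b - t * (1 - t) * d a b ^ 2.

Lemma lower_semicont_dist_sq {Y : Type} (d : Y -> Y -> R) (p : Y) :
  is_metric d -> lower_semicont d (fun y => d y p ^ 2).
Proof.
  intros (Hnn & _ & Hs & Htr) y e He.
  pose proof (Hnn y p) as Hyp.
  (* For [r = d y z < 1], the increment of the squared distance is at most
     [r * (2 * d y p + 3 * r)]. *)
  exists (Rmin 1 (e / (2 * d y p + 3))). split.
  { apply Rmin_glb_lt; [lra|]. apply Rdiv_lt_0_compat; lra. }
  intros z Hz. set (r := d y z) in *.
  assert (Hr1 : r < 1) by (eapply Rlt_le_trans; [exact Hz | apply Rmin_l]).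
  assert (Hr2 : r * (2 * d y p + 3) <= e).
  { apply Rmult_le_reg_r with (/ (2 * d y p + 3)); [apply Rinv_0_lt_compat; lra|].
    rewrite Rmult_assoc, Rinv_r, Rmult_1_r by lra.
    left. eapply Rlt_le_trans; [exact Hz | apply Rmin_r]. }
  pose proof (Htr y z p) as H1. pose proof (Htr z y p) as H2.
  rewrite (Hs z y) in H2. fold r in H1, H2.
  assert (0 <= r) by apply Hnn. pose proof (Hnn z p).
  assert (d y p ^ 2 <= (r + d z p) ^ 2) by (apply pow_incr; lra).
  nra.
Qed.

Lemma lower_semicont_minus_const {Y : Type} (d : Y -> Y -> R) (F : Y -> R) (c : R) :
  lower_semicont d F -> lower_semicont d (fun y => F y - c).
Proof.
  intros H y e He. destruct (H y e He) as (r & Hr & Hz).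
  exists r. split; auto. intros z Hyz. specialize (Hz z Hyz). lra.
Qed.

Lemma lower_semicont_wsum {Y T : Type} (d : Y -> Y -> R) (l : list (R * T)) (F : T -> Y -> R) :
  nonneg_weights l -> (forall x, lower_semicont d (F x)) ->
  lower_semicont d (fun y => wsum l (fun x => F x y)).
Proof.
  intros Hl HF. induction l as [|[w x] l IH]; intros y e He.
  - exists 1. split; [lra|]. intros; simpl; lra.
  - inversion_clear Hl as [|? ? Hw Hl']. cbn [fst] in Hw.
    destruct (IH Hl' y (e / 2) ltac:(lra)) as (r1 & Hr1 & H1).
    destruct (HF x y (e / 2 / (w + 1))) as (r2 & Hr2 & H2).
    { apply Rdiv_lt_0_compat; lra. }
    exists (Rmin r1 r2). split; [now apply Rmin_glb_lt|]. intros z Hz.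
    specialize (H1 z (Rlt_le_trans _ _ _ Hz (Rmin_l _ _))).
    specialize (H2 z (Rlt_le_trans _ _ _ Hz (Rmin_r _ _))).
    apply (Rmult_le_compat_l w) in H2; [|exact Hw].
    assert (w * (e / 2 / (w + 1)) = e / 2 - e / 2 / (w + 1)) by (field; lra).
    assert (0 < e / 2 / (w + 1)) by (apply Rdiv_lt_0_compat; lra).
    simpl. lra.
Qed.

(** Strong convexity makes minimizing sequences Cauchy. Applied between the minimizer and [y] with
    [t] tending to 0, it also gives the quadratic growth. *)
Lemma strongly_convex_minimizer {Y : Type} (d : Y -> Y -> R) (C : Y -> Prop) (F : Y -> R) (m0 : R) :
  is_metric d -> complete d -> (exists y, C y) ->
  (forall y, (forall e, 0 < e -> exists z, C z /\ d y z < e) -> C y) ->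
  (forall y, C y -> m0 <= F y) -> lower_semicont d F -> strongly_convex d C F ->
  exists b, C b /\ forall y, C y -> F b + d b y ^ 2 <= F y.
Proof.
  intros Hm Hc [y0 Hy0] Hcl Hlow Hlsc Hconv.
  assert (Hinf : exists m, (forall y, C y -> m <= F y) /\
     forall e, 0 < e -> exists y, C y /\ F y < m + e).
  { destruct (completeness (fun v => exists y, C y /\ v = - F y)) as [M [HM1 HM2]].
    - exists (- m0). intros v (y & Hy & ->). specialize (Hlow y Hy). lra.
    - exists (- F y0). eauto.
    - exists (- M). split.
      + intros y Hy. assert (- F y <= M) by (apply HM1; eauto). lra.
      + intros e He. apply NNPP. intros Hno.
        assert (M <= M - e); [|lra]. apply HM2. intros v (y & Hy & ->).
        destruct (Rlt_dec (F y) (- M + e)); [exfalso; eauto | lra]. }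
  destruct Hinf as (m & Hm1 & Hm2).
  destruct (complete_shrinking d (fun e y => C y /\ F y < m + e)) as [b Hb]; auto.
  { intros e e' y Hee [Hy HF]. split; auto. lra. }
  (* With [t = 1/2], two points whose values exceed the infimum by less than [e^2 / 4] satisfy
     [d y z ^ 2 / 4 < e^2 / 4]. *)
  { intros e He. exists (e ^ 2 / 4). split; [nra|].
    intros y z [Hy HFy] [Hz HFz].
    destruct (Hconv y z (1/2) Hy Hz ltac:(lra)) as (c & HC & HFc).
    specialize (Hm1 c HC).
    apply Rnot_le_lt. intros Hle.
    assert (e ^ 2 <= d y z ^ 2) by (apply pow_incr; lra). lra. }
  assert (HCb : C b).
  { apply Hcl. intros e He. destruct (Hb e He) as (z & [Hz _] & Hd).
    exists z. split; auto. destruct Hm as (_ & _ & Hs & _). now rewrite Hs. }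
  assert (HFb : F b <= m).
  { apply le_epsilon. intros e He. destruct (Hlsc b (e / 2) ltac:(lra)) as (r & Hr & H).
    destruct (Hb (Rmin r (e / 2))) as (z & [Hz HFz] & Hd).
    { apply Rmin_glb_lt; lra. }
    destruct Hm as (_ & _ & Hs & _). rewrite Hs in Hd.
    specialize (H z (Rlt_le_trans _ _ _ Hd (Rmin_l _ _))).
    pose proof (Rmin_r r (e / 2)). lra. }
  exists b. split; auto. intros y Hy. apply le_epsilon. intros e He.
  pose proof (pow2_ge_0 (d b y)) as Hd. set (D := d b y ^ 2) in *.
  (* Dividing the convexity inequality by [t] leaves a defect [t * D], which this choice keeps below
     [e]. *)
  set (t := Rmin 1 (e / (D + 1))).
  assert (Ht0 : 0 < t) by (apply Rmin_glb_lt; [lra | apply Rdiv_lt_0_compat; lra]).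
  assert (Ht1 : t <= 1) by apply Rmin_l.
  assert (Ht2 : t * (D + 1) <= e).
  { apply Rle_trans with (e / (D + 1) * (D + 1)).
    - apply Rmult_le_compat_r; [lra | apply Rmin_r].
    - right. field. lra. }
  destruct (Hconv b y t HCb Hy ltac:(lra)) as (c & HC & HFc). fold D in HFc.
  specialize (Hm1 c HC).
  assert (0 <= t * (F y - F b - (1 - t) * D)) by nra.
  assert (0 <= F y - F b - (1 - t) * D) by nra. nra.
Qed.

(** Averaging Stewart's inequality with total weight 1 gives strong convexity with modulus 1. The
    offsets [r], later the squared distances allowed, only shift the function by a constant. *)
Lemma cat0_barycenter {Y T : Type} (d : Y -> Y -> R) (l : list (R * T)) (pt : T -> Y) (r : T -> R) :
  CAT0 d -> complete d -> inhabited Y -> nonneg_weights l -> total_weight l = 1 ->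
  exists b, forall y, wsum l (fun x => d b (pt x) ^ 2 - r x) + d b y ^ 2
                      <= wsum l (fun x => d y (pt x) ^ 2 - r x).
Proof.
  intros Hd Hc [y0] Hl Hw.
  assert (Hm := proj1 (proj1 Hd)).
  destruct (strongly_convex_minimizer d (fun _ => True)
    (fun y => wsum l (fun x => d y (pt x) ^ 2 - r x)) (wsum l (fun x => - r x)))
    as (b & _ & Hb); eauto.
  - intros y _. apply wsum_le; auto. intros x. pose proof (pow2_ge_0 (d y (pt x))). lra.
  - apply lower_semicont_wsum; auto. intros x.
    apply lower_semicont_minus_const. now apply lower_semicont_dist_sq.
  - intros a b t _ _ Ht. destruct (proj2 (proj1 Hd) a b) as [g Hg].
    exists (g t). split; auto.
    apply Rle_trans with (wsum l (fun x => (1 - t) * (d a (pt x) ^ 2 - r x)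
      + t * (d b (pt x) ^ 2 - r x) + (- (t * (1 - t) * d a b ^ 2)))).
    + apply wsum_le; auto. intros x.
      pose proof (cat0_stewart d g a b (pt x) t Hd Hg Ht). lra.
    + rewrite !wsum_plus, wsum_const, Hw, !wsum_mult. lra.
Qed.

(* The dual problem: over finitely supported weights [l] on [G], the values
   [min_y sum_i l_i (d(y, y_i)^2 - D(z, z_i))] are nonpositive by [lss].
   Barycentres of almost optimal weights form a Cauchy family, and moving a little
   weight to a point of [G] shows that their limit satisfies its constraint. *)
Lemma one_point_extension {Z Y : Type} (D : Z -> Z -> R) (d : Y -> Y -> R)
  (G : Z * Y -> Prop) (z : Z) :
  CAT0 d -> complete d -> inhabited Y ->
  (forall a b, 0 <= D a b) -> lss D ->
  (forall p q, G p -> G q -> d (snd p) (snd q) ^ 2 <= D (fst p) (fst q)) ->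
  exists y, forall p, G p -> d y (snd p) ^ 2 <= D z (fst p).
Proof.
  intros Hd Hc Hinh HD Hlss HG.
  destruct (classic (exists p, G p)) as [[p0 Hp0] | Hempty].
  2:{ destruct Hinh as [y0]. exists y0. intros p Hp. exfalso. eauto. }
  assert (Hm := proj1 (proj1 Hd)).
  set (phi := fun y (p : Z * Y) => d y (snd p) ^ 2 - D z (fst p)).
  (* [phi y p] is the defect of the constraint imposed by [p]: it is nonpositive when [y] satisfies
     that constraint. *)
  set (adm := fun l : list (R * (Z * Y)) =>
     nonneg_weights l /\ Forall (fun wx => G (snd wx)) l /\ total_weight l = 1).
  set (min := fun l b => forall y, wsum l (phi b) + d b y ^ 2 <= wsum l (phi y)).
  assert (Hmin : forall l, adm l -> exists b, min l b).
  { intros l (Hl1 & _ & Hl3).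
    apply (cat0_barycenter d l snd (fun p => D z (fst p)) Hd Hc Hinh Hl1 Hl3). }
  assert (Hadm1 : forall p, G p -> adm ((1, p) :: nil)).
  { intros p Hp. repeat split.
    - constructor; [simpl; lra | constructor].
    - constructor; [exact Hp | constructor].
    - unfold total_weight. simpl. ring. }
  assert (Hadm2 : forall l1 l2 t, adm l1 -> adm l2 -> 0 <= t <= 1 ->
     exists l, adm l /\ forall F, wsum l F = (1 - t) * wsum l1 F + t * wsum l2 F).
  { intros l1 l2 t (H1 & H2 & H3) (H4 & H5 & H6) Ht.
    set (l := map (fun wx => ((1 - t) * fst wx, snd wx)) l1
              ++ map (fun wx => (t * fst wx, snd wx)) l2).
    assert (Hl : forall F, wsum l F = (1 - t) * wsum l1 F + t * wsum l2 F)
      by (intros F; unfold l; rewrite wsum_app, !wsum_scale; reflexivity).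
    exists l. split; [|exact Hl]. repeat split.
    - apply Forall_app. split; apply Forall_map; cbn [fst];
        [revert H1 | revert H4]; apply Forall_impl; intros a Ha;
        apply Rmult_le_pos; [lra | exact Ha | lra | exact Ha].
    - apply Forall_app. split; apply Forall_map; assumption.
    - unfold total_weight in *. rewrite Hl, H3, H6. ring. }
  (* Test the minimality of [b] at each prescribed value [snd q] and average over [q]. This bounds
     [2 * V] by the double sum of [D], which [lss] bounds by [2 * S]. *)
  assert (Hneg : forall l b, adm l -> min l b -> wsum l (phi b) <= 0).
  { intros l b (Hl1 & Hl2 & Hl3) Hb.
    set (S := wsum l (fun p => D z (fst p))).
    set (V := wsum l (fun p => d b (snd p) ^ 2)).
    assert (HV : wsum l (phi b) = V - S).
    { unfold phi, V, S. replace (wsum l (fun p => d b (snd p) ^ 2)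
       - wsum l (fun p => D z (fst p))) with (wsum l (fun p => d b (snd p) ^ 2)
       + (-1) * wsum l (fun p => D z (fst p))) by ring.
      rewrite <- wsum_mult, <- wsum_plus. apply wsum_ext. intros; ring. }
    assert (H1 : wsum l (fun q => wsum l (phi b) + d b (snd q) ^ 2)
       <= wsum l (fun q => wsum l (fun p => D (fst q) (fst p) + (-1) * D z (fst p)))).
    { apply (wsum_le_on G); auto. intros q Hq.
      eapply Rle_trans; [apply Hb|]. apply (wsum_le_on G); auto. intros p Hp.
      unfold phi. specialize (HG q p Hq Hp). lra. }
    pose proof (lss_pullback D fst Hlss (z, b) l Hl1) as H2. cbn [fst] in H2.
    assert (E1 : wsum l (fun q => wsum l (phi b) + d b (snd q) ^ 2) = V - S + V).
    { rewrite wsum_plus, wsum_const, HV, Hl3. fold V. ring. }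
    assert (E2 : wsum l (fun q => wsum l (fun p => D (fst q) (fst p) + (-1) * D z (fst p)))
       = wsum l (fun q => wsum l (fun p => D (fst q) (fst p))) - S).
    { rewrite (wsum_ext l _ (fun q => wsum l (fun p => D (fst q) (fst p)) + (- S))).
      - rewrite wsum_plus, wsum_const, Hl3. ring.
      - intros q. rewrite wsum_plus, wsum_mult. fold S. ring. }
    assert (E3 : wsum l (fun a => wsum l (fun b => D z (fst a) + D z (fst b) - D (fst a) (fst b)))
       = 2 * S - wsum l (fun q => wsum l (fun p => D (fst q) (fst p)))).
    { rewrite (wsum_ext l _ (fun q => D z (fst q) + (S + (-1) * wsum l (fun p => D (fst q) (fst p))))).
      - rewrite wsum_plus, wsum_plus, wsum_mult, wsum_const, Hl3. fold S. ring.
      - intros q.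
        rewrite (wsum_ext l _ (fun p => D z (fst q) + (D z (fst p) + (-1) * D (fst q) (fst p))))
          by (intros; ring).
        rewrite !wsum_plus, wsum_mult, wsum_const, Hl3. fold S. ring. }
    lra. }
  destruct (completeness (fun v => exists l b, adm l /\ min l b /\ v = wsum l (phi b)))
    as [c [Hc1 Hc2]].
  { exists 0. intros v (l & b & Hl & Hb & ->). auto. }
  { destruct (Hmin _ (Hadm1 p0 Hp0)) as [b Hb]. exists (wsum ((1, p0) :: nil) (phi b)). eauto 6. }
  assert (Hc0 : c <= 0).
  { apply Hc2. intros v (l & b & Hl & Hb & ->). auto. }
  assert (Hle : forall l b, adm l -> min l b -> wsum l (phi b) <= c)
    by (intros l b Hl Hb; apply Hc1; eauto).
  destruct (complete_shrinking d (fun e b => exists l, adm l /\ min l b /\ c - e < wsum l (phi b)))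
    as [y Hy]; auto.
  { intros e He. apply NNPP. intros Hno. assert (c <= c - e); [|lra].
    apply Hc2. intros v (l & b & Hl & Hb & ->).
    destruct (Rlt_dec (c - e) (wsum l (phi b))); [exfalso; eauto 6 | lra]. }
  { intros e e' b Hee (l & Hl & Hb & H). exists l. repeat split; try apply Hl; auto. lra. }
  (* The value at the averaged weights is at most [c], so the squared distances from [b1] and [b2]
     to its barycentre sum to less than twice [e^2 / 5]. Hence [(d b1 b + d b2 b)^2] is below
     [4/5 * e^2]. *)
  { intros e He. exists (e ^ 2 / 5). split; [nra|].
    intros b1 b2 (l1 & Hl1 & Hb1 & H1) (l2 & Hl2 & Hb2 & H2).
    destruct (Hadm2 l1 l2 (1/2) Hl1 Hl2 ltac:(lra)) as (l & Hl & El).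
    destruct (Hmin l Hl) as [b Hb]. pose proof (Hle l b Hl Hb) as H3.
    rewrite El in H3. specialize (Hb1 b). specialize (Hb2 b).
    destruct Hm as (Hnn & _ & Hs & Htr). pose proof (Htr b1 b b2) as H4.
    rewrite (Hs b b2) in H4.
    apply Rnot_le_lt. intros H5.
    assert (e ^ 2 <= (d b1 b + d b2 b) ^ 2) by (apply pow_incr; lra).
    pose proof (pow2_ge_0 (d b1 b - d b2 b)). nra. }
  exists y. intros p Hp. set (r := D z (fst p)). assert (Hr : 0 <= r) by apply HD.
  apply le_epsilon. intros e He.
  destruct (lower_semicont_dist_sq d (snd p) Hm y (e / 2) ltac:(lra)) as (rho & Hrho & Hlsc).
  (* The bounds in [s0] control the final defect; those in [s1] keep the new barycentre within [rho]
     of [y]. *)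
  set (s0 := Rmin (1/2) (e / 2)).
  set (s1 := Rmin (rho / 2) (rho ^ 2 / (8 * (1 + 2 * r)))).
  set (s := Rmin s0 s1).
  assert (Hs0 : 0 < s0) by (apply Rmin_glb_lt; lra).
  assert (Hs1 : 0 < s1) by (apply Rmin_glb_lt; [lra | apply Rdiv_lt_0_compat; nra]).
  assert (Hs : 0 < s) by (now apply Rmin_glb_lt).
  assert (s <= s0) by apply Rmin_l. assert (Hss1 : s <= s1) by apply Rmin_r.
  assert (Hsa : s <= 1/2) by (pose proof (Rmin_l (1/2) (e / 2)); unfold s0 in *; lra).
  assert (Hsb : s <= e / 2) by (pose proof (Rmin_r (1/2) (e / 2)); unfold s0 in *; lra).
  assert (Hsc : s <= rho / 2).
  { eapply Rle_trans; [exact Hss1 | apply Rmin_l]. }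
  assert (Hsd : s * (1 + 2 * r) <= rho ^ 2 / 8).
  { apply Rle_trans with (rho ^ 2 / (8 * (1 + 2 * r)) * (1 + 2 * r)).
    - apply Rmult_le_compat_r; [lra|]. eapply Rle_trans; [exact Hss1 | apply Rmin_r].
    - right. field. lra. }
  destruct (Hy (s ^ 2) ltac:(nra)) as (bn & (ln & Hln & Hbn & Hvn) & Hdn).
  destruct (Hadm2 ln _ s Hln (Hadm1 p Hp) ltac:(lra)) as (l & Hl & El).
  destruct (Hmin l Hl) as [b Hb]. pose proof (Hle l b Hl Hb) as H3.
  rewrite El in H3. simpl in H3. specialize (Hbn b).
  set (f := phi b p) in *. assert (Hf : - r <= f)
    by (unfold f, phi; fold r; pose proof (pow2_ge_0 (d b (snd p))); lra).
  (* Weight [s] has been moved to [p], and the new value still does not exceed [c]. Since [c <= 0],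
     replacing [(1 - s) * c] by [c] is harmless. *)
  assert (H4 : (1 - s) * d bn b ^ 2 + s * f <= s ^ 2).
  { assert ((1 - s) * (c - s ^ 2 + d bn b ^ 2) <= (1 - s) * wsum ln (phi b))
      by (apply Rmult_le_compat_l; lra). nra. }
  assert (Hfs : f <= s).
  { assert (0 <= (1 - s) * d bn b ^ 2) by (apply Rmult_le_pos; [lra | apply pow2_ge_0]). nra. }
  assert (Hbb : d bn b ^ 2 <= rho ^ 2 / 8).
  { pose proof (pow2_ge_0 (d bn b)).
    assert (1/2 * d bn b ^ 2 <= (1 - s) * d bn b ^ 2) by (apply Rmult_le_compat_r; lra).
    assert (s * - r <= s * f) by (apply Rmult_le_compat_l; lra). nra. }
  assert (Hyb : d y b < rho).
  { destruct Hm as (Hnn & _ & Hsym & Htr). pose proof (Htr y bn b) as H5.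
    rewrite (Hsym y bn) in H5.
    assert (d bn b < rho / 2).
    { apply Rnot_le_lt. intros H6.
      assert ((rho / 2) ^ 2 <= d bn b ^ 2) by (apply pow_incr; lra). nra. }
    assert (d bn y < rho / 2) by nra. lra. }
  specialize (Hlsc b Hyb). cbv beta in Hlsc. unfold f, phi in Hfs. fold r in Hfs. lra.
Qed.

(** * Kirszbraun's theorem and convex hulls *)

Lemma kirszbraun_extension {Z Y : Type} (D : Z -> Z -> R) (d : Y -> Y -> R)
  (G0 : Z * Y -> Prop) :
  CAT0 d -> complete d -> inhabited Y ->
  (forall a b, 0 <= D a b) -> (forall a b, D a b = D b a) -> (forall a, D a a = 0) -> lss D ->
  (forall p q, G0 p -> G0 q -> d (snd p) (snd q) ^ 2 <= D (fst p) (fst q)) ->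
  exists F : Z -> Y, (forall a b, d (F a) (F b) ^ 2 <= D a b) /\
    forall a y, G0 (a, y) -> F a = y.
Proof.
  intros Hd Hc Hinh HD Hsym HD0 Hlss HG0.
  destruct (proj1 (proj1 Hd)) as (Hnn & Hd0 & Hs & Htr).
  (* The prescribed graph [G0] is part of the compatibility test, so the union of an empty chain is
     covered by the hypothesis on [G0]. *)
  set (compat := fun G : Z * Y -> Prop => forall p q, G0 p \/ G p -> G0 q \/ G q ->
     d (snd p) (snd q) ^ 2 <= D (fst p) (fst q)).
  destruct (@classical_sets.Zorn_bigcup (Z * Y) compat) as (G & HG & Hmax).
  { intros F HF Htot p q Hp Hq.
    destruct Hp as [Hp | [A HA Hp]]; destruct Hq as [Hq | [B HB Hq]].
    - auto.
    - apply (HF B HB); auto.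
    - apply (HF A HA); auto.
    - destruct (Htot A B HA HB) as [HAB | HAB].
      + apply (HF B HB); right; [now apply HAB | exact Hq].
      + apply (HF A HA); right; [exact Hp | now apply HAB]. }
  destruct (functional_choice (fun z y => G0 (z, y) \/ G (z, y))) as [F HF].
  { intros z.
    destruct (one_point_extension D d (fun p => G0 p \/ G p) z) as [y Hy]; auto.
    exists y. apply NNPP. intros Hno.
    (* A compatible value at [z] could be added to the maximal graph, so it already belongs to
       it. *)
    apply (Hmax (fun p => G p \/ p = (z, y))).
    - split; [intros p Hp; now left|]. intros Hsub. apply Hno. right. apply Hsub. now right.
    - assert (Hself : d y y ^ 2 <= D z z).
      { rewrite HD0, (proj2 (Hd0 y y) eq_refl). lra. }
      intros p q Hp Hq.
      assert (Hp' : (G0 p \/ G p) \/ p = (z, y)) by tauto.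
      assert (Hq' : (G0 q \/ G q) \/ q = (z, y)) by tauto.
      destruct Hp' as [Hp' | ->]; destruct Hq' as [Hq' | ->]; cbn [fst snd]; auto.
      rewrite Hs, Hsym. auto. }
  exists F. split.
  - intros a b. exact (HG _ _ (HF a) (HF b)).
  - intros a y Ha. apply Hd0.
    pose proof (HG _ _ (HF a) (or_introl Ha)) as H. cbn [fst snd] in H. rewrite HD0 in H.
    pose proof (Hnn (F a) y). nra.
Qed.

(** * Convex hulls, nearest-point projection and Lipschitz constants *)

Definition gconvex {Y : Type} (d : Y -> Y -> R) (C : Y -> Prop) : Prop :=
  forall g p q t, C p -> C q -> geodesic d g p q -> 0 <= t <= 1 -> C (g t).

Definition gclosed {Y : Type} (d : Y -> Y -> R) (C : Y -> Prop) : Prop :=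
  forall y, closure d C y -> C y.

(** The closed neighbourhood of radius [r], with slack [e] because the distance to [C] need not be
    attained. *)
Definition thickening {Y : Type} (d : Y -> Y -> R) (C : Y -> Prop) (r : R) (y : Y) : Prop :=
  forall e, 0 < e -> exists z, C z /\ d y z < r + e.

Lemma geodesic_rev {Y : Type} (d : Y -> Y -> R) (g : R -> Y) (p q : Y) :
  is_metric d -> geodesic d g p q -> geodesic d (fun t => g (1 - t)) q p.
Proof.
  intros (_ & _ & Hs & _) (H0 & H1 & H). repeat split.
  - now rewrite Rminus_0_r.
  - now rewrite Rminus_diag.
  - intros s t Hs' Ht. rewrite H, (Hs q p), Rabs_minus_sym by lra. f_equal. f_equal. ring.
Qed.

Lemma sq_le {a b : R} : 0 <= b -> a ^ 2 <= b ^ 2 -> a <= b.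
Proof. intros Hb H. apply Rnot_lt_le. intros Hlt. nra. Qed.

(** Apply Stewart's inequality along both geodesics; the terms involving [o] cancel. *)
Lemma cat0_contraction {Y : Type} (d : Y -> Y -> R) (g h : R -> Y) (o y z : Y) (t : R) :
  CAT0 d -> geodesic d g o y -> geodesic d h o z -> 0 <= t <= 1 ->
  d (g t) (h t) <= t * d y z.
Proof.
  intros Hd Hg Hh Ht. destruct (proj1 (proj1 Hd)) as (Hnn & _ & Hs & _).
  pose proof (cat0_stewart d g o y (h t) t Hd Hg Ht) as H1.
  pose proof (cat0_stewart d h o z y t Hd Hh Ht) as H2.
  rewrite (proj1 (geodesic_range d h o z t Hh Ht)) in H1.
  rewrite (Hs (h t) y), (Hs z y) in H2.
  apply sq_le; [apply Rmult_le_pos; [lra | apply Hnn]|].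
  apply (Rmult_le_compat_l t) in H2; [|lra]. nra.
Qed.

(** Insert the diagonal geodesic from [p] to [q'] and contract once towards each of its ends. *)
Lemma cat0_geodesics_dist {Y : Type} (d : Y -> Y -> R) (g h : R -> Y) (p q p' q' : Y) (t : R) :
  CAT0 d -> geodesic d g p q -> geodesic d h p' q' -> 0 <= t <= 1 ->
  d (g t) (h t) <= (1 - t) * d p p' + t * d q q'.
Proof.
  intros Hd Hg Hh Ht. assert (Hm := proj1 (proj1 Hd)).
  destruct (proj2 (proj1 Hd) p q') as [k Hk].
  pose proof (cat0_contraction d g k p q q' t Hd Hg Hk Ht) as H1.
  pose proof (cat0_contraction d _ _ q' p p' (1 - t) Hd (geodesic_rev d k _ _ Hm Hk)
    (geodesic_rev d h _ _ Hm Hh) ltac:(lra)) as H2.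
  cbv beta in H2. replace (1 - (1 - t)) with t in H2 by ring.
  destruct Hm as (_ & _ & _ & Htr). pose proof (Htr (g t) (k t) (h t)). lra.
Qed.

Lemma gconvex_thickening {Y : Type} (d : Y -> Y -> R) (C : Y -> Prop) (r : R) :
  CAT0 d -> gconvex d C -> gconvex d (thickening d C r).
Proof.
  intros Hd HC g p q t Hp Hq Hg Ht e He.
  destruct (Hp e He) as (p' & Hp' & Hdp). destruct (Hq e He) as (q' & Hq' & Hdq).
  destruct (proj2 (proj1 Hd) p' q') as [h Hh].
  exists (h t). split; [now apply (HC h p' q')|].
  pose proof (cat0_geodesics_dist d g h p q p' q' t Hd Hg Hh Ht).
  destruct (Req_dec t 0) as [-> | Ht0]; [lra|].
  assert (t * d q q' < t * (r + e)) by (apply Rmult_lt_compat_l; lra).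
  assert ((1 - t) * d p p' <= (1 - t) * (r + e)) by (apply Rmult_le_compat_l; lra). lra.
Qed.

Lemma gclosed_thickening {Y : Type} (d : Y -> Y -> R) (C : Y -> Prop) (r : R) :
  is_metric d -> gclosed d (thickening d C r).
Proof.
  intros (_ & _ & _ & Htr) y Hy e He.
  destruct (Hy (e / 2) ltac:(lra)) as (z & Hz & Hyz).
  destruct (Hz (e / 2) ltac:(lra)) as (w & Hw & Hzw).
  exists w. split; auto. pose proof (Htr y z w). lra.
Qed.

Lemma thickening_0 {Y : Type} (d : Y -> Y -> R) (C : Y -> Prop) (y : Y) :
  thickening d C 0 y <-> closure d C y.
Proof.
  split; intros H e He; destruct (H e He) as (z & Hz & Hd); exists z; split; auto; lra.
Qed.

Lemma Gn_mono {Y : Type} (d : Y -> Y -> R) (C : Y -> Prop) (m n : nat) (y : Y) :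
  geodesic_space d -> (m <= n)%nat -> Gn d C m y -> Gn d C n y.
Proof.
  intros Hd Hmn Hy. induction Hmn as [|n _ IH]; auto.
  destruct (proj2 Hd y y) as [g Hg]. exists y, y, g, 0.
  repeat split; auto; try apply Hg; try lra. symmetry. apply Hg.
Qed.

Lemma gconvex_co {Y : Type} (d : Y -> Y -> R) (C : Y -> Prop) :
  geodesic_space d -> gconvex d (co d C).
Proof.
  intros Hd g p q t [m Hp] [n Hq] Hg Ht. exists (S (Nat.max m n)).
  exists p, q, g, t. repeat split; try apply Hg; try apply Ht.
  - apply Gn_mono with m; auto; lia.
  - apply Gn_mono with n; auto; lia.
Qed.

Lemma gconvex_clco {Y : Type} (d : Y -> Y -> R) (C : Y -> Prop) :
  CAT0 d -> gconvex d (clco d C).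
Proof.
  intros Hd g p q t Hp Hq Hg Ht. apply thickening_0.
  apply (gconvex_thickening d (co d C) 0 Hd (gconvex_co d C (proj1 Hd)) g p q t); auto;
    now apply thickening_0.
Qed.

Lemma gclosed_clco {Y : Type} (d : Y -> Y -> R) (C : Y -> Prop) :
  is_metric d -> gclosed d (clco d C).
Proof.
  intros Hm y Hy. apply thickening_0. apply gclosed_thickening; auto.
  intros e He. destruct (Hy e He) as (z & Hz & Hd). exists z. split; auto.
  now apply thickening_0.
Qed.

Lemma closure_incl {Y : Type} (d : Y -> Y -> R) (C : Y -> Prop) (y : Y) :
  is_metric d -> C y -> closure d C y.
Proof.
  intros (_ & H0 & _) Hy e He. exists y. split; auto. rewrite (proj2 (H0 y y) eq_refl). exact He.
Qed.

Lemma clco_incl {Y : Type} (d : Y -> Y -> R) (C : Y -> Prop) (y : Y) :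
  is_metric d -> C y -> clco d C y.
Proof. intros Hm Hy. apply closure_incl; auto. exists 0%nat. exact Hy. Qed.

Lemma clco_least {Y : Type} (d : Y -> Y -> R) (C S : Y -> Prop) :
  gconvex d S -> gclosed d S -> (forall y, C y -> S y) -> forall y, clco d C y -> S y.
Proof.
  intros Hconv Hcl Hsub y Hy. apply Hcl. intros e He.
  destruct (Hy e He) as (z & [n Hz] & Hd). exists z. split; auto. clear Hy Hd.
  revert z Hz. induction n as [|n IH]; intros z Hz; [now apply Hsub|].
  destruct Hz as (p & q & g & t & Hp & Hq & Hg & Ht & ->).
  apply (Hconv g p q t); auto.
Qed.

(** The thickening is closed, convex and contains the values of [f], hence also their closed
    hull. *)
Lemma clco_thickening {I Y : Type} (d : Y -> Y -> R) (f g : I -> Y) (r : R) (y : Y) :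
  CAT0 d -> (forall i, d (f i) (g i) <= r) ->
  clco d (fun y => exists i, f i = y) y -> thickening d (clco d (fun y => exists i, g i = y)) r y.
Proof.
  intros Hd Hfg. assert (Hm := proj1 (proj1 Hd)). apply clco_least.
  - apply gconvex_thickening; auto. now apply gconvex_clco.
  - now apply gclosed_thickening.
  - intros z [i <-] e He. exists (g i). split; [|specialize (Hfg i); lra].
    apply clco_incl; eauto.
Qed.

(** Compare [b] and [e] with the midpoint of [a] and [c], then use
    [(x + y)^2 <= 2 * x^2 + 2 * y^2]. *)
Lemma cat0_quadrilateral {Y : Type} (d : Y -> Y -> R) (a b c e : Y) :
  CAT0 d -> d a c ^ 2 + d b e ^ 2 <= d a b ^ 2 + d b c ^ 2 + d c e ^ 2 + d e a ^ 2.
Proof.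
  intros Hd. destruct (proj2 (proj1 Hd) a c) as [g Hg].
  pose proof (cat0_stewart d g a c b (1/2) Hd Hg ltac:(lra)) as H1.
  pose proof (cat0_stewart d g a c e (1/2) Hd Hg ltac:(lra)) as H2.
  destruct (proj1 (proj1 Hd)) as (Hnn & _ & Hs & Htr).
  pose proof (Htr b (g (1/2)) e) as H3. rewrite (Hs b (g (1/2))) in H3.
  assert (d b e ^ 2 <= (d (g (1/2)) b + d (g (1/2)) e) ^ 2) by (apply pow_incr; auto).
  pose proof (pow2_ge_0 (d (g (1/2)) b - d (g (1/2)) e)).
  rewrite (Hs b c), (Hs e a). nra.
Qed.

(** The quadratic growth at the two nearest points, added to the quadrilateral inequality, makes the
    projection nonexpansive. *)
Lemma cat0_projection {Y : Type} (d : Y -> Y -> R) (C : Y -> Prop) :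
  CAT0 d -> complete d -> (exists y, C y) -> gconvex d C -> gclosed d C ->
  exists P : Y -> Y, (forall y, C (P y)) /\ (forall y z, C z -> d y (P y) <= d y z) /\
    (forall y, C y -> P y = y) /\ forall y z, d (P y) (P z) <= d y z.
Proof.
  intros Hd Hc HC Hconv Hcl. assert (Hm := proj1 (proj1 Hd)).
  destruct (functional_choice
    (fun x b => C b /\ forall y, C y -> d b x ^ 2 + d b y ^ 2 <= d y x ^ 2))
    as [P HP].
  { intros x. apply (strongly_convex_minimizer d C (fun y => d y x ^ 2) 0); auto.
    - intros y _. apply pow2_ge_0.
    - now apply lower_semicont_dist_sq.
    - intros a b t Ha Hb Ht. destruct (proj2 (proj1 Hd) a b) as [g Hg].
      exists (g t). split; [now apply (Hconv g a b)|].
      now apply cat0_stewart. }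
  destruct Hm as (Hnn & H0 & Hs & Htr).
  exists P. split; [|split; [|split]].
  - intros y. apply HP.
  - intros y z Hz. apply sq_le; [apply Hnn|].
    pose proof (proj2 (HP y) z Hz). rewrite (Hs y (P y)), (Hs y z).
    pose proof (pow2_ge_0 (d (P y) z)). lra.
  - intros y Hy. apply H0. pose proof (proj2 (HP y) y Hy) as H.
    rewrite (proj2 (H0 y y) eq_refl) in H. pose proof (Hnn (P y) y). nra.
  - intros y z. apply sq_le; [apply Hnn|].
    pose proof (proj2 (HP y) (P z) (proj1 (HP z))) as H1.
    pose proof (proj2 (HP z) (P y) (proj1 (HP y))) as H2.
    pose proof (cat0_quadrilateral d y z (P z) (P y) Hd) as H3.
    rewrite (Hs (P z) y) in H1. rewrite (Hs (P y) z), (Hs (P z) (P y)) in H2.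
    rewrite (Hs z (P z)), (Hs (P z) (P y)) in H3. lra.
Qed.

(** The infimum of the Lipschitz constants is attained, each defining inequality being closed in
    [K]. *)
Lemma is_Lip_exists {S T : Type} (dS : S -> S -> R) (dT : T -> T -> R) (f : S -> T) :
  (forall x y, 0 <= dS x y) -> (exists K, lip_const dS dT f K) -> exists L, is_Lip dS dT f L.
Proof.
  intros HS [K0 HK0].
  destruct (completeness (fun v => exists K, lip_const dS dT f K /\ v = - K)) as [m [Hm1 Hm2]].
  - exists 0. intros v (K & [HK _] & ->). lra.
  - exists (- K0). eauto.
  - assert (Hlow : forall K, lip_const dS dT f K -> - m <= K).
    { intros K HK. assert (- K <= m) by (apply Hm1; eauto). lra. }
    exists (- m). split; [split|exact Hlow].
    + assert (m <= 0); [|lra]. apply Hm2. intros v (K & [HK _] & ->). lra.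
    + intros x y. apply Rnot_lt_le. intros Hlt.
      destruct (Req_dec (dS x y) 0) as [E | E].
      { destruct HK0 as [_ HK0]. specialize (HK0 x y). rewrite E in *. lra. }
      assert (Hpos : 0 < dS x y) by (specialize (HS x y); lra).
      assert (m <= - (dT (f x) (f y) / dS x y)).
      { apply Hm2. intros v (K & [_ HK] & ->). apply Ropp_le_contravar.
        apply Rmult_le_reg_r with (dS x y); auto. unfold Rdiv.
        rewrite Rmult_assoc, Rinv_l by lra. specialize (HK x y). lra. }
      assert (dT (f x) (f y) / dS x y * dS x y = dT (f x) (f y)) by (field; lra). nra.
Qed.

(** For [L > 0], some pair of points violates the constant [(1 - theta) * L] strictly; moving each
    of the two values by at most half the gap leaves [K] no room below it. *)
Lemma is_Lip_perturb {S T : Type} (dS : S -> S -> R) (dT : T -> T -> R) (f : S -> T) (L theta : R) :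
  is_metric dT -> (forall x y, 0 <= dS x y) -> is_Lip dS dT f L -> 0 < theta <= 1 ->
  exists r, 0 < r /\ forall g K, (forall x, dT (f x) (g x) <= r) -> lip_const dS dT g K ->
    (1 - theta) * L <= K.
Proof.
  intros (Hnn & _ & Hs & Htr) HS [HL Hmin] Ht.
  destruct (Req_dec L 0) as [-> | HL0].
  { exists 1. split; [lra|]. intros g K _ [HK _]. lra. }
  assert (HLpos : 0 < L) by (destruct HL; lra).
  assert (Hex : exists x y, (1 - theta) * L * dS x y < dT (f x) (f y)).
  { apply NNPP. intros Hno. assert (L <= (1 - theta) * L); [|nra].
    apply Hmin. split; [nra|]. intros x y. apply Rnot_lt_le. intros Hlt. apply Hno. eauto. }
  destruct Hex as (x & y & Hxy).
  exists ((dT (f x) (f y) - (1 - theta) * L * dS x y) / 2). split; [lra|].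
  intros g K Hg [HK HgK].
  assert (Hpos : 0 < dS x y).
  { destruct (HS x y) as [H|H]; auto. exfalso. rewrite <- H in Hxy.
    destruct HL as [_ HL]. specialize (HL x y). rewrite <- H in HL. lra. }
  apply Rmult_le_reg_r with (dS x y); auto.
  pose proof (Hg x) as H1. pose proof (Hg y) as H2. rewrite Hs in H2. specialize (HgK x y).
  pose proof (Htr (f x) (g x) (f y)). pose proof (Htr (g x) (g y) (f y)). lra.
Qed.

(** * Lower semicontinuity *)

Lemma extension_near {X Y : Type} (dX : X -> X -> R) (dY : Y -> Y -> R) (A : X -> Prop)
  (g : {x : X | A x} -> Y) (h : X -> Y) (K M beta rho : R) :
  CBB0 dX -> CAT0 dY -> complete dY -> inhabited Y -> 0 <= rho ->
  lip_const (subdist dX A) dY g K -> lip_const dX dY h K ->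
  (forall x y, dY (h x) (h y) <= M) -> (forall a, dY (g a) (h (proj1_sig a)) <= beta) ->
  0 <= beta -> beta ^ 2 + 2 * beta * M <= rho ^ 2 ->
  exists g' : X -> Y, lip_const dX dY g' K /\ (forall a, g' (proj1_sig a) = g a) /\
    forall x, dY (g' x) (h x) <= rho.
Proof.
  intros HX HY Hc Hinh Hrho [HK Hg] [_ Hh] HM Hgh Hbeta Hsmall.
  destruct (proj1 (proj1 HX)) as (HX0 & HXeq & HXs & HXt).
  destruct (proj1 (proj1 HY)) as (HY0 & HYeq & HYs & HYt).
  set (D := fun p q : X * R => K ^ 2 * dX (fst p) (fst q) ^ 2 + (snd p - snd q) ^ 2).
  (* With [v <= M], expanding [(beta + v)^2] leaves an excess of at most [beta^2 + 2 * beta * M]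
     over [v^2], which the height [rho] absorbs. *)
  assert (Hcross : forall a x, dY (g a) (h x) ^ 2 <= K ^ 2 * dX (proj1_sig a) x ^ 2 + rho ^ 2).
  { intros a x. pose proof (HYt (g a) (h (proj1_sig a)) (h x)) as H1.
    pose proof (Hgh a) as H2. pose proof (HM (proj1_sig a) x) as H3.
    pose proof (Hh (proj1_sig a) x) as H4. set (v := dY (h (proj1_sig a)) (h x)) in *.
    assert (Hv : 0 <= v) by apply HY0.
    assert (dY (g a) (h x) ^ 2 <= (beta + v) ^ 2) by (apply pow_incr; split; [apply HY0 | lra]).
    assert (v ^ 2 <= (K * dX (proj1_sig a) x) ^ 2) by (apply pow_incr; lra).
    assert (beta * v <= beta * M) by (apply Rmult_le_compat_l; lra). nra. }
  destruct (kirszbraun_extension D dY (fun p =>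
      (exists a, p = ((proj1_sig a, 0), g a)) \/ (exists x, p = ((x, rho), h x))))
    as (F & HF & HFG); auto.
  - intros p q. unfold D. apply Rplus_le_le_0_compat; [|apply pow2_ge_0].
    apply Rmult_le_pos; apply pow2_ge_0.
  - intros p q. unfold D. rewrite (HXs (fst p)). ring.
  - intros p. unfold D. rewrite (proj2 (HXeq _ _) eq_refl). ring.
  - apply lss_plus.
    + apply lss_scale; [apply pow2_ge_0|].
      apply (lss_pullback (fun x y => dX x y ^ 2) fst). now apply cbb0_lss.
    + apply (lss_pullback (fun s t => (s - t) ^ 2) snd). apply lss_R.
  - intros p q [[a ->] | [x ->]] [[b ->] | [y ->]]; unfold D; cbn [fst snd].
    + rewrite <- Rpow_mult_distr. specialize (Hg a b). unfold subdist in Hg.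
      replace (0 - 0) with 0 by ring.
      apply Rle_trans with ((K * dX (proj1_sig a) (proj1_sig b)) ^ 2); [|lra].
      apply pow_incr. split; [apply HY0 | exact Hg].
    + specialize (Hcross a y). lra.
    + specialize (Hcross b x). rewrite HYs, HXs. lra.
    + rewrite <- Rpow_mult_distr. specialize (Hh x y).
      replace (rho - rho) with 0 by ring.
      apply Rle_trans with ((K * dX x y) ^ 2); [|lra].
      apply pow_incr. split; [apply HY0 | exact Hh].
  - exists (fun x => F (x, 0)). repeat split; auto.
    + intros x y. apply sq_le; [apply Rmult_le_pos; auto|].
      pose proof (HF (x, 0) (y, 0)) as H. unfold D in H. cbn [fst snd] in H.
      rewrite Rpow_mult_distr. lra.
    + intros a. apply HFG. left. now exists a.
    + intros x. rewrite <- (HFG (x, rho) (h x)) by (right; now exists x).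
      apply sq_le; auto.
      pose proof (HF (x, 0) (x, rho)) as H. unfold D in H. cbn [fst snd] in H.
      rewrite (proj2 (HXeq x x) eq_refl) in H. lra.
Qed.

Theorem theorem4p7 (X Y : Type) (dX : X -> X -> R) (dY : Y -> Y -> R)
  (A : X -> Prop) :
  CBB0 dX -> CAT0 dY -> complete dY -> (exists a, A a) ->
  lsc (subdist dX A) dY dX dY (Psi_c dX dY A).
Proof.
  intros HX HY Hc [a0 Ha0] V [_ HVopen].
  split; [intros f [H _]; exact H|].
  intros f [Hf (h & (([M HM] & _) & Hhf & (L & HLf & HLh) & Hhull) & HVh)].
  destruct (HVopen h HVh) as (e & He & Hball).
  assert (HXm := proj1 (proj1 HX)). assert (HYm := proj1 (proj1 HY)).
  assert (HX0 : forall x y, 0 <= dX x y) by apply HXm.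
  destruct (proj1 (proj1 HY)) as (HY0 & HYeq & HYs & HYt).
  assert (HM0 : 0 <= M) by (eapply Rle_trans; [apply (HY0 (h a0) (h a0)) | apply HM]).
  (* The final distance to [h] is at most [rho + kappa <= 2 * rho = e / 2]. *)
  set (rho := e / 4). assert (Hrho : 0 < rho) by (unfold rho; lra).
  (* Any [beta <= kappa] meets the smallness condition of [extension_near], as [kappa <= rho]. One
     half of [kappa] is spent on the contraction, the other on the distance from [f] to [g]. *)
  set (kappa := rho ^ 2 / (rho + 2 * M)).
  assert (Hkappa : 0 < kappa) by (apply Rdiv_lt_0_compat; [apply pow_lt|]; lra).
  assert (Hkrho : kappa * (rho + 2 * M) = rho ^ 2) by (unfold kappa; field; lra).
  assert (Hkr : kappa <= rho) by (apply Rmult_le_reg_r with (rho + 2 * M); nra).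
  set (theta := Rmin (1/2) (kappa / 2 / (M + 1))).
  assert (Ht0 : 0 < theta).
  { apply Rmin_glb_lt; [lra|]. apply Rdiv_lt_0_compat; lra. }
  assert (Ht1 : theta <= 1/2) by apply Rmin_l.
  assert (HtM : theta * M <= kappa / 2).
  { apply Rle_trans with (theta * (M + 1)); [lra|].
    apply Rle_trans with (kappa / 2 / (M + 1) * (M + 1)).
    - apply Rmult_le_compat_r; [lra | apply Rmin_r].
    - right. field. lra. }
  destruct (is_Lip_perturb (subdist dX A) dY f L theta HYm) as (r & Hr & Hpert); auto.
  { intros x y. apply HX0. }
  { lra. }
  exists (Rmin r (kappa / 2)). split; [apply Rmin_glb_lt; lra|].
  intros g Hg (delta & Hdelta & Hfg). split; [exact Hg|].
  assert (Hd1 : delta < r) by (eapply Rlt_le_trans; [exact Hdelta | apply Rmin_l]).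
  assert (Hd2 : delta < kappa / 2) by (eapply Rlt_le_trans; [exact Hdelta | apply Rmin_r]).
  assert (Hd0 : 0 <= delta)
    by (eapply Rle_trans; [apply HY0 | apply (Hfg (exist _ a0 Ha0))]).
  destruct (is_Lip_exists (subdist dX A) dY g) as [K HK].
  { intros x y. apply HX0. }
  { apply Hg. }
  assert (HLK : (1 - theta) * L <= K).
  { apply (Hpert g K); [|apply HK]. intros x. specialize (Hfg x). lra. }
  (* A centre in the image of [h] lies within [M] of every value, so contracting by [1 - theta]
     moves points by at most [theta * M]. *)
  set (o := h a0).
  destruct (functional_choice (fun y k => geodesic dY k o y) (proj2 (proj1 HY) o)) as [G HG].
  set (hc := fun x => G (h x) (1 - theta)).
  assert (Hhc : forall x y, dY (hc x) (hc y) <= (1 - theta) * dY (h x) (h y)).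
  { intros x y. apply cat0_contraction with o; auto. lra. }
  assert (Hhch : forall x, dY (hc x) (h x) <= theta * M).
  { intros x. unfold hc.
    rewrite (proj2 (geodesic_range dY (G (h x)) o (h x) (1 - theta) (HG _) ltac:(lra))).
    replace (1 - (1 - theta)) with theta by ring.
    apply Rmult_le_compat_l; [lra | apply HM]. }
  destruct (extension_near dX dY A g hc K M (theta * M + delta) rho)
    as (g1 & Hg1 & Hg1A & Hg1h); auto.
  { lra. }
  { apply HK. }
  { split; [apply (proj1 HK)|]. intros x y. eapply Rle_trans; [apply Hhc|].
    apply Rle_trans with ((1 - theta) * (L * dX x y)).
    - apply Rmult_le_compat_l; [lra | apply (proj1 HLh)].
    - rewrite <- Rmult_assoc. apply Rmult_le_compat_r; auto. }
  { intros x y. eapply Rle_trans; [apply Hhc|].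
    pose proof (HM x y). pose proof (HY0 (h x) (h y)). nra. }
  { intros a. specialize (Hfg a). specialize (Hhch (proj1_sig a)).
    rewrite HYs in Hhch. rewrite <- Hhf in Hfg. rewrite HYs in Hfg.
    pose proof (HYt (g a) (h (proj1_sig a)) (hc (proj1_sig a))). lra. }
  { nra. }
  { assert (0 <= theta * M + delta <= kappa) by nra. nra. }
  set (C := clco dY (fun y => exists a, g a = y)).
  assert (HC : forall a, C (g a)) by (intros a; apply clco_incl; eauto).
  destruct (cat0_projection dY C) as (P & HPC & HPmin & HPfix & HPlip); auto.
  { exists (g (exist _ a0 Ha0)). apply HC. }
  { now apply gconvex_clco. }
  { now apply gclosed_clco. }
  (* [h x] is within [delta] of the hull of [g], and [P] does not increase the distance
     [theta * M + rho] between [h x] and [g1 x]. *)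
  assert (Hclose : forall x, dY (h x) (P (g1 x)) <= rho + kappa).
  { intros x.
    assert (H1 : dY (h x) (P (h x)) <= delta).
    { apply le_epsilon. intros eps Heps.
      destruct (clco_thickening dY f g delta (h x) HY Hfg (Hhull x) eps Heps) as (z & Hz & Hd).
      pose proof (HPmin (h x) z Hz). lra. }
    pose proof (HPlip (h x) (g1 x)) as H2.
    pose proof (HYt (h x) (hc x) (g1 x)) as H3. pose proof (Hg1h x) as H4.
    pose proof (Hhch x) as H5. rewrite HYs in H4, H5.
    pose proof (HYt (h x) (P (h x)) (P (g1 x))). lra. }
  assert (HgL : lip_const dX dY (fun x => P (g1 x)) K).
  { split; [apply HK|]. intros x y. eapply Rle_trans; [apply HPlip | apply Hg1]. }
  assert (Hbdd : bdd_lip dX dY (fun x => P (g1 x))).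
  { split; [|eauto]. exists (M + 2 * (rho + kappa)). intros x y.
    pose proof (Hclose x) as H1. pose proof (Hclose y) as H2. rewrite HYs in H1.
    pose proof (HYt (P (g1 x)) (h x) (P (g1 y))). pose proof (HYt (h x) (h y) (P (g1 y))).
    pose proof (HM x y). lra. }
  assert (HgA : forall a, P (g1 (proj1_sig a)) = g a)
    by (intros a; rewrite Hg1A; apply HPfix, HC).
  exists (fun x => P (g1 x)). split.
  - split; [exact Hbdd|]. split; [exact HgA|]. split; [|intros x; apply HPC].
    exists K. split; [exact HK|]. split; [exact HgL|].
    (* A Lipschitz constant of the extension restricts to one of [g], so it is at least [K]. *)
    intros K' [HK' HL']. apply HK. split; auto.
    intros a b. rewrite <- !HgA. apply HL'.
  - apply Hball; auto. exists (rho + kappa). split; [unfold rho in *; lra | exact Hclose].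
Qed.
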